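(* Let $\alpha \in \Lambda^k(\mathbb{R}^n)^*$ be a calibration. If the stabilizer of $\alpha$ in $\mathrm{GL}(n,\mathbb{R})$ is closed under transposition, then $\alpha$ has the following affine non-squeezing property: if $\psi$ is an affine map preserving $\alpha$ for which $\psi(B(r)) \subset Z_L(R)$ for some $\alpha$-calibrated subspace $L$, then $r \leq R$.
   Context: $\mathbb{R}^n$ carries the standard Euclidean inner product. A $k$-form $\alpha\in\Lambda^k(\mathbb{R}^n)^*$ is a calibration if $|\alpha(v_1,\dots,v_k)|\leq 1$ for all orthonormal $v_1,\dots,v_k\in\mathbb{R}^n$, with equality for at least one such $k$-tuple. A $k$-dimensional oriented subspace $L$ of $\mathbb{R}^n$ is $\alpha$-calibrated if $\alpha(v_1,\dots,v_k)=1$ for some (equivalently every) oriented orthonormal basis $v_1,\dots,v_k$ of $L$. The stabilizer of $\alpha$ is $\{A\in\mathrm{GL}(n,\mathbb{R}) : A^*\alpha=\alpha\}$. An affine map $\psi(x)=\Psi x+x_0$ preserves $\alpha$ if $\Psi^*\alpha=\alpha$. $r,R>0$ are real numbers, $B(r)$ is the closed ball of radius $r$ centered at the origin in $\mathbb{R}^n$, and $Z_L(R)=\{x\in\mathbb{R}^n : |\mathrm{proj}_L(x)|^2\leq R^2\}$, where $\mathrm{proj}_L$ is the orthogonal projection onto $L$. *)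

(* Defs.v *)
From HB Require Import structures.
From mathcomp Require Import all_boot all_order all_algebra.
From mathcomp Require Import classical_sets reals.

Set Implicit Arguments.
Unset Strict Implicit.
Unset Printing Implicit Defensive.

Import Order.TTheory GRing.Theory Num.Theory.
Local Open Scope ring_scope.
Local Open Scope classical_set_scope.

Definition dot (R : realType) (n : nat) (u v : 'cV[R]_n) : R :=
  (u^T *m v) 0 0.

Section DotInstances.
Variables (R : realType) (n : nat).

Fact dot_is_bilinear :
  bilinear_for (GRing.Scale.Law.clone _ _ *%R _)
    (GRing.Scale.Law.clone _ _ (idfun \; *%R) _) (@dot R n).
Proof.
split=> [v|u] a x y; rewrite /dot /=.
- by rewrite linearD /= linearZ /= mulmxDl -scalemxAl !mxE.
- by rewrite mulmxDr -scalemxAr !mxE.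
Qed.

HB.instance Definition _ :=
  bilinear_isBilinear.Build R _ _ _ _ _ (@dot R n) dot_is_bilinear.

Fact dot_is_symmetric (u v : 'cV[R]_n) :
  dot u v = (-1) ^+ false * idfun (dot v u).
Proof.
rewrite expr0 mul1r /dot /= !mxE; apply: eq_bigr => i _.
by rewrite !mxE mulrC.
Qed.

HB.instance Definition _ :=
  @isHermitianSesquilinear.Build R _ false idfun (@dot R n) dot_is_symmetric.

Fact dot_gt0 (u : 'cV[R]_n) : u != 0 -> 0 < dot u u.
Proof.
move=> /cV0Pn[i ui]; rewrite /dot mxE (bigD1 i) //= mxE -expr2.
rewrite ltr_wpDr ?exprn_even_gt0 //.
by apply: sumr_ge0 => j _; rewrite mxE -expr2 sqr_ge0.
Qed.

HB.instance Definition _ := isDotProduct.Build R _ (@dot R n) dot_gt0.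

End DotInstances.

Definition enorm (R : realType) (n : nat) (x : 'cV[R]_n) : R :=
  Num.sqrt (dot x x).

Definition replace (T : Type) (k : nat) (v : k.-tuple T) (i : 'I_k) (x : T) :
    k.-tuple T :=
  [tuple if j == i then x else tnth v j | j < k].

Record altform (R : realType) (k n : nat) := AltForm {
  altform_fun :> k.-tuple 'cV[R]_n -> R;
  altform_multilinear : forall (v : k.-tuple 'cV[R]_n) (i : 'I_k),
    scalar (fun x : 'cV[R]_n => altform_fun (replace v i x));
  altform_alternating : forall (v : k.-tuple 'cV[R]_n) (i j : 'I_k),
    i != j -> tnth v i = tnth v j -> altform_fun v = 0
}.

Definition pullback (R : realType) (k n : nat) (A : 'M[R]_n)
    (alpha : altform R k n) (v : k.-tuple 'cV[R]_n) : R :=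
  alpha [tuple A *m tnth v i | i < k].

Definition preserves (R : realType) (k n : nat) (A : 'M[R]_n)
    (alpha : altform R k n) : Prop :=
  pullback A alpha =1 alpha.

Definition stabilizer (R : realType) (k n : nat) (alpha : altform R k n) :
    set 'M[R]_n :=
  [set A | A \in unitmx /\ preserves A alpha].

Definition calibration (R : realType) (k n : nat) (alpha : altform R k n) :
    Prop :=
  (forall v : k.-tuple 'cV[R]_n,
     orthonormal (@dot R n) v -> `|alpha v| <= 1) /\
  (exists2 v : k.-tuple 'cV[R]_n,
     orthonormal (@dot R n) v & `|alpha v| = 1).

(* The orientation is represented by a reference basis: a basis is positively
   oriented when its change-of-basis determinant to [oframe] is positive.
   For [k = 0] this leaves only the positive orientation of the zero space. *)
Record oriented_subspace (R : realType) (k n : nat) := OrientedSubspace {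
  osubspace :> {vspace 'cV[R]_n};
  oframe : k.-tuple 'cV[R]_n;
  oframe_basis : basis_of osubspace oframe
}.

Definition oriented_basis (R : realType) (k n : nat)
    (L : oriented_subspace R k n) (v : k.-tuple 'cV[R]_n) : Prop :=
  basis_of L v /\
  0 < \det (\matrix_(i < k, j < k) coord (oframe L) j (tnth v i)).

Definition calibrated (R : realType) (k n : nat) (alpha : altform R k n)
    (L : oriented_subspace R k n) : Prop :=
  exists v : k.-tuple 'cV[R]_n,
    [/\ oriented_basis L v, orthonormal (@dot R n) v & alpha v = 1].

Definition orthoproj (R : realType) (n : nat) (L : {vspace 'cV[R]_n}) :
    'End('cV[R]_n) :=
  daddv_pi L (orthov (@dot R n) L).

(* The library's [closed_ball] on matrices is for the sup norm. *)
Definition eball (R : realType) (n : nat) (r : R) : set 'cV[R]_n :=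
  [set x | enorm x <= r].

Definition cylinder (R : realType) (n : nat) (L : {vspace 'cV[R]_n})
    (rho : R) : set 'cV[R]_n :=
  [set x | enorm (orthoproj L x) ^+ 2 <= rho ^+ 2].

Definition affine_map (R : realType) (n : nat) (Psi : 'M[R]_n)
    (x0 x : 'cV[R]_n) : 'cV[R]_n :=
  Psi *m x + x0.

(* Main.v *)
Require Import Defs.
From HB Require Import structures.
From mathcomp Require Import all_boot all_order all_algebra.
From mathcomp Require Import classical_sets reals.
From mathcomp Require Import ring lra.

Set Implicit Arguments.
Unset Strict Implicit.
Unset Printing Implicit Defensive.

Import Order.TTheory GRing.Theory Num.Theory.
Local Open Scope ring_scope.
Local Open Scope classical_set_scope.

(** Write [Psi] for the linear part of the map and [v] for an oriented
    orthonormal basis of [L], so that [alpha v = 1].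

    If [Psi^T] also preserves [alpha], the conclusion is a Hadamard inequality.
    The ball is symmetric, so the translation is irrelevant and the inclusion
    in the cylinder gives [`|dot (tnth v i) (Psi *m y)| <= rho] on the ball of
    radius [r]; moving [Psi] to the other side and taking [y] along
    [Psi^T *m tnth v i] shows that each of these [k] vectors has norm at most
    [rho / r]. A form bounded by 1 on orthonormal tuples is bounded by the
    product of the norms on arbitrary tuples ([comass_hadamard]), hence
    [1 = alpha v = alpha (Psi^T v) <= (rho / r) ^+ k] and [r <= rho].

    The hypothesis on transposes concerns invertible matrices only, so it must
    also be shown that a matrix preserving [alpha] is invertible
    ([preserves_unitmx]). A kernel vector [x] of such a matrix is annihilated
    by [alpha] in every slot. Then every shear [1 + x u^T] preserves [alpha],
    and so does its transpose [1 + u x^T], at least when these are invertible.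
    The transpose sends [x] to [x + `|x|^2 u], and being in the kernel of
    [alpha] is invariant under the stabilizer; so if [x] were nonzero, [u]
    would be in the kernel too. Since [u] is essentially arbitrary, [alpha]
    would vanish, whereas a calibration does not
    ([closed_trmx_nondegenerate]). *)

(** * Euclidean geometry of column vectors *)

Section Euclidean.
Variables (R : realType) (n : nat).
Implicit Types x y u v : 'cV[R]_n.

Lemma dotC x y : dot x y = dot y x.
Proof. by rewrite dot_is_symmetric expr0 mul1r. Qed.

Lemma dotZr a x y : dot x (a *: y) = a * dot x y.
Proof. exact: linearZr_LR. Qed.

Lemma dotZl a x y : dot (a *: x) y = a * dot x y.
Proof. exact: linearZl_LR. Qed.

Lemma dot0r x : dot x 0 = 0.
Proof. exact: linear0r. Qed.

Lemma dotDr x y u : dot x (y + u) = dot x y + dot x u.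
Proof. exact: linearDr. Qed.

Lemma dotNr x y : dot x (- y) = - dot x y.
Proof. exact: linearNr. Qed.

Lemma dotBr x y u : dot x (y - u) = dot x y - dot x u.
Proof. exact: linearBr. Qed.

Lemma dotBl x y u : dot (x - y) u = dot x u - dot y u.
Proof. exact: linearBl. Qed.

Lemma dot_sumr I (s : seq I) (P : pred I) (F : I -> 'cV[R]_n) x :
  dot x (\sum_(i <- s | P i) F i) = \sum_(i <- s | P i) dot x (F i).
Proof. exact: linear_sumr. Qed.

Lemma dot_ge0 x : 0 <= dot x x.
Proof.
have [->|/dot_gt0/ltW//] := eqVneq x 0.
by rewrite dot0r.
Qed.

Lemma dotvv x : dot x x = enorm x ^+ 2.
Proof. by rewrite sqr_sqrtr ?dot_ge0. Qed.

Lemma enorm_ge0 x : 0 <= enorm x.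
Proof. exact: sqrtr_ge0. Qed.

Lemma enorm_gt0 x : x != 0 -> 0 < enorm x.
Proof. by move=> x0; rewrite sqrtr_gt0 dot_gt0. Qed.

Lemma enormZ a x : enorm (a *: x) = `|a| * enorm x.
Proof. by rewrite /enorm dotZl dotZr mulrA -expr2 sqrtrM ?sqr_ge0 ?sqrtr_sqr. Qed.

Lemma dot_mulmx (A : 'M[R]_n) x y : dot x (A *m y) = dot (A^T *m x) y.
Proof. by rewrite /dot trmx_mul trmxK mulmxA. Qed.

(** Cauchy-Schwarz against a unit vector [x], read off from the squared norm
    of the component of [y] orthogonal to [x]. *)
Lemma norm_dot_le x y : enorm x = 1 -> `|dot x y| <= enorm y.
Proof.
move=> x1; rewrite -(ler_pXn2r (ltn0Sn 1)) ?nnegrE ?enorm_ge0 // -dotvv.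
rewrite real_normK ?num_real //.
have := dot_ge0 (y - dot x y *: x).
rewrite dotBl !dotBr !dotZl !dotZr (dotvv x) x1 (dotC y x).
by rewrite expr1n mulr1 subrr subr0 subr_ge0 -expr2.
Qed.

Lemma enorm_le_addl x y : dot x y = 0 -> enorm y <= enorm (x + y).
Proof.
move=> xy; rewrite ler_wsqrtr // dotDr !(dotC (x + y)) !dotDr (dotC y x) xy.
by rewrite addr0 add0r lerDr dot_ge0.
Qed.

Lemma orthonormal_tnthP k (v : k.-tuple 'cV[R]_n) :
  reflect (forall i j, dot (tnth v i) (tnth v j) = (i == j)%:R)
          (orthonormal (@dot R n) v).
Proof.
have E (s : seq 'cV[R]_n) :
    pair_ortho_rec (@dot R n) s = pairwise (fun x y => dot x y == 0) s.
  by elim: s => //= x s ->; rewrite andbT.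
rewrite /orthonormal E.
apply: (iffP andP) => [[/all_tnthP v1 /(pairwiseP 0) v0]|vE].
  have lt0 (i j : 'I_k) : (i < j)%N -> dot (tnth v i) (tnth v j) = 0.
    by move=> ij; apply/eqP; rewrite !(tnth_nth 0) v0 ?inE ?size_tuple.
  move=> i j; case: (ltngtP i j) => [ij|ji|/val_inj->].
  - by rewrite lt0 // -val_eqE ltn_eqF.
  - by rewrite dotC lt0 // -val_eqE gtn_eqF.
  - by rewrite eqxx; apply/eqP/v1.
split; first by apply/all_tnthP => i /=; rewrite vE eqxx.
apply/(pairwiseP 0) => i j; rewrite !inE size_tuple => ik jk ij.
have := vE (Ordinal ik) (Ordinal jk); rewrite !(tnth_nth 0) /= => ->.
by rewrite -val_eqE /= ltn_eqF.
Qed.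

(** This self-adjointness of the projection is how the cylinder condition is
    turned into bounds on scalar products. The projection is given as the one
    along the orthogonal complement, so the work is to see that the subspace
    and its complement are in direct sum and span the space. *)
Lemma dot_orthoproj k (v : k.-tuple 'cV[R]_n) (L : {vspace 'cV[R]_n}) i y :
  basis_of L v -> orthonormal (@dot R n) v ->
  dot (tnth v i) (orthoproj L y) = dot (tnth v i) y.
Proof.
move=> vL /orthonormal_tnthP vE.
have vin j : tnth v j \in L by rewrite (basis_mem vL) ?mem_tnth.
have disj : (L :&: orthov (@dot R n) L = 0)%VS.
  apply/eqP; rewrite -subv0; apply/subvP => x /memv_capP[xL /mem_orthovP xo].
  by rewrite memv0; apply/negPn/negP => /dot_gt0; rewrite xo ?ltxx.
have full : y \in (L + orthov (@dot R n) L)%VS.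
  set p := \sum_j dot (tnth v j) y *: tnth v j.
  rewrite -(subrKC p y) memv_add //.
    by rewrite memv_suml // => j _; rewrite memvZ.
  rewrite mem_orthov_sym.
  apply/subvP => z; rewrite -(span_basis vL) => /(@coord_span _ _ _ v) ->.
  rewrite memv_suml // => j _; rewrite memvZ // mem_orthov1 -(tnth_nth 0).
  change (dot (tnth v j) (y - p) == 0).
  rewrite dotBr dot_sumr (bigD1 j) //= big1 ?addr0 => [|l lj].
    by rewrite dotZr vE eqxx mulr1 subrr.
  by rewrite dotZr vE eq_sym (negbTE lj) mulr0.
rewrite -{2}(daddv_pi_add disj full) dotDr.
have /mem_orthovP/(_ _ (vin i)) po := memv_pi (orthov (@dot R n) L) L y.
by rewrite [X in _ = _ + X]dotC [X in _ = _ + X]po addr0.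
Qed.

Lemma shear_unitmx x u :
  1 + dot u x != 0 -> 1%:M + x *m u^T \in unitmx.
Proof.
set c := 1 + dot u x => c0.
(* Sherman-Morrison formula for the inverse of a rank one perturbation. *)
suff /mulmx1_unit[] : (1%:M + x *m u^T) *m (1%:M - c^-1 *: (x *m u^T))
    = 1%:M by [].
have xx : x *m u^T *m (x *m u^T) = dot u x *: (x *m u^T).
  by rewrite mulmxA -(mulmxA x) [u^T *m x]mx11_scalar mul_mx_scalar -scalemxAl.
rewrite mulmxBr mulmx1 mulmxDl mul1mx -scalemxAr xx scalerA -scalerDl.
by rewrite -[X in X + _ * _]mulr1 -mulrDr -/c mulVf // scale1r addrK.
Qed.

End Euclidean.

(** * Multilinearity and the Hadamard inequality *)

Section AlternatingForms.
Variables (R : realType) (k n : nat) (alpha : altform R k n).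
Implicit Types (v w : k.-tuple 'cV[R]_n) (i j : 'I_k).

Definition slot v i (x : 'cV[R]_n) : R := alpha (replace v i x).

HB.instance Definition _ v i :=
  GRing.isLinear.Build R _ _ _ (slot v i) (altform_multilinear alpha v i).

Lemma tnth_replace v i x j :
  tnth (replace v i x) j = if j == i then x else tnth v j.
Proof. by rewrite tnth_mktuple. Qed.

Lemma slot_tnth v i : slot v i (tnth v i) = alpha v.
Proof.
congr (alpha _); apply: eq_from_tnth => j; rewrite tnth_replace.
by case: eqP => [->|].
Qed.

Lemma slot_repeat v i j : j != i -> slot v i (tnth v j) = 0.
Proof.
move=> ji; apply: (@altform_alternating _ _ _ alpha _ i j); first by rewrite eq_sym.
by rewrite !tnth_replace eqxx (negbTE ji).
Qed.

Lemma slot_pullback A v i x :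
  preserves A alpha ->
  slot v i x = slot [tuple A *m tnth v j | j < k] i (A *m x).
Proof.
move=> hA; rewrite /slot -hA; congr (alpha _); apply: eq_from_tnth => j.
by rewrite !tnth_mktuple; case: eqP.
Qed.

(** Gram-Schmidt, performed inside the form. Subtracting from one vector its
    projection on the preceding ones does not change the value of [alpha], and
    does not increase the norm; normalizing what remains then trades a factor
    of [alpha] for the same factor of the product. *)
Lemma comass_hadamard v :
  (forall w, orthonormal (@dot R n) w -> `|alpha w| <= 1) ->
  `|alpha v| <= \prod_i enorm (tnth v i).
Proof.
move=> comass.
(* The first [l] vectors are already orthonormal and [m] are yet to be treated. *)
suff gs m l w : (l + m)%N = k ->
    (forall i j, (i < l)%N -> (j < l)%N ->
       dot (tnth w i) (tnth w j) = (i == j)%:R) ->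
    `|alpha w| <= \prod_i enorm (tnth w i).
  exact: (gs k 0).
elim: m l w => [l w|m IH l w].
  rewrite addn0 => -> wE; rewrite big1 => [|i _]; last first.
    by rewrite /enorm wE // eqxx sqrtr1.
  by apply/comass/orthonormal_tnthP => i j; rewrite wE.
rewrite addnS => lmk wE.
have lk : (l < k)%N by rewrite -lmk ltnS leq_addr.
pose i0 := Ordinal lk.
pose p := \sum_(i : 'I_k | (i < l)%N) dot (tnth w i) (tnth w i0) *: tnth w i.
pose u := tnth w i0 - p.
have ou i : (i < l)%N -> dot (tnth w i) u = 0.
  move=> il; rewrite dotBr dot_sumr (bigD1 i) //= big1 ?addr0 => [|j].
    by rewrite dotZr (wE i i) // eqxx mulr1 subrr.
  by case/andP=> jl ji; rewrite dotZr (wE i j) // eq_sym (negbTE ji) mulr0.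
have pu : dot p u = 0.
  rewrite dotC dot_sumr big1 // => i il.
  by rewrite dotZr (dotC u) ou ?mulr0.
have uE : enorm u <= enorm (tnth w i0).
  by rewrite -(subrKC p (tnth w i0)) enorm_le_addl.
have aE : alpha w = slot w i0 u.
  rewrite linearB linear_sum /= slot_tnth big1 ?subr0 // => i il.
  by rewrite linearZ /= slot_repeat ?mulr0 // -val_eqE /= ltn_eqF.
have prod_ge0 (P : pred 'I_k) : 0 <= \prod_(i | P i) enorm (tnth w i).
  by apply: prodr_ge0 => i _; exact: enorm_ge0.
have [u0|u0] := eqVneq u 0; first by rewrite aE u0 linear0 normr0.
have nu := enorm_gt0 u0.
pose e := (enorm u)^-1 *: u.
have e1 : enorm e = 1 by rewrite enormZ gtr0_norm ?invr_gt0 // mulVf ?gt_eqF.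
have -> : alpha w = enorm u * slot w i0 e.
  by rewrite aE [in RHS]linearZ /= mulrA mulfV ?gt_eqF // mul1r.
rewrite normrM gtr0_norm // (bigD1 i0) //= ler_pM ?enorm_ge0 //.
have oe i : (i < l)%N -> dot (tnth w i) e = 0.
  by move=> il; rewrite dotZr ou ?mulr0.
have := IH l.+1 (replace w i0 e) lmk.
rewrite (bigD1 i0) //= tnth_replace eqxx e1 mul1r => H.
rewrite (le_trans (H _)) {H}//; last first.
  rewrite le_eqVlt; apply/orP; left; apply/eqP/eq_bigr => i ii0.
  by rewrite tnth_replace (negbTE ii0).
move=> i j; rewrite !ltnS !tnth_replace => il jl.
have lt i' : (i' <= l)%N -> i' != i0 -> (i' < l)%N.
  by move=> il' ii0; rewrite ltn_neqAle il' andbT; rewrite -val_eqE in ii0.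
have [->|ii0] := eqVneq i i0; have [ji|ji0] := eqVneq j i0; rewrite ?eqxx ?ji.
- by rewrite dotvv e1 expr1n.
- by rewrite dotC oe ?lt.
- by rewrite oe ?lt // (negbTE ii0).
- by rewrite wE ?lt.
Qed.

(** * Stabilizers closed under transposition *)

(** The vectors are exchanged one at a time: [h m] has its first [m] entries
    from [w] and the others from [v], and consecutive values of [alpha] differ
    by a term that the hypothesis annihilates. *)
Lemma altform_mod_kernel v w :
  (forall (t : k.-tuple 'cV[R]_n) i, slot t i (tnth w i - tnth v i) = 0) ->
  alpha w = alpha v.
Proof.
move=> vw; pose h m := [tuple if (i < m)%N then tnth w i else tnth v i | i < k].
have hw : h k = w by apply: eq_from_tnth => i; rewrite tnth_mktuple ltn_ord.
have hv : h 0 = v by apply: eq_from_tnth => i; rewrite tnth_mktuple.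
suff H m : (m <= k)%N -> alpha (h m) = alpha v by rewrite -hw H.
elim: m => [|m IH] mk; first by rewrite hv.
pose i0 := Ordinal mk.
have E t i : tnth (h t) i = if (i < t)%N then tnth w i else tnth v i.
  by rewrite tnth_mktuple.
have hS : h m.+1 = replace (h m) i0 (tnth w i0).
  apply: eq_from_tnth => i; rewrite tnth_replace !E ltnS leq_eqVlt -val_eqE /=.
  by have [im|] := eqVneq; rewrite //= (_ : i = i0) //; apply: val_inj.
have -> : alpha (h m.+1) = slot (h m) i0 (tnth w i0) by rewrite hS.
rewrite -(subrK (tnth v i0) (tnth w i0)) linearD /= vw add0r.
have -> : tnth v i0 = tnth (h m) i0 by rewrite E ltnn.
by rewrite slot_tnth IH // ltnW.
Qed.

Lemma preserves_shear (x u : 'cV[R]_n) :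
  (forall w i, slot w i x = 0) -> preserves (1%:M + x *m u^T) alpha.
Proof.
move=> x0 v; apply: altform_mod_kernel => t i.
rewrite tnth_mktuple mulmxDl mul1mx addrC addKr -mulmxA.
by rewrite [u^T *m _]mx11_scalar mul_mx_scalar linearZ /= x0 mulr0.
Qed.

(** The shear along [x] in the direction dual to a vector [tnth v i0] preserves
    [alpha], and its transpose moves [x] out of the kernel of [alpha]. An index
    [i0] is required because a form of degree 0 is a constant: its kernel is
    the whole space although it may be nonzero. *)
Lemma closed_trmx_nondegenerate (i0 : 'I_k) v (x : 'cV[R]_n) :
  (forall A, stabilizer alpha A -> stabilizer alpha A^T) ->
  alpha v != 0 -> (forall w i, slot w i x = 0) -> x = 0.
Proof.
move=> htr v0 x0; apply/eqP/negPn/negP => xn0.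
(* The scaling [s] only serves to make the shear invertible. *)
pose s : R := if dot (tnth v i0) x == -1 then 2 else 1.
pose u := s *: tnth v i0.
have sn0 : s != 0 by rewrite /s; case: ifP; rewrite ?oner_eq0 ?pnatr_eq0.
have c0 : 1 + dot u x != 0.
  rewrite dotZl /s; have [->|] := eqVneq (dot _ x) (-1); first by apply/eqP; lra.
  by rewrite mul1r; apply: contra => /eqP ?; apply/eqP; lra.
have [] : stabilizer alpha (1%:M + x *m u^T)^T.
  by apply: htr; split; [exact: shear_unitmx|exact: preserves_shear].
set B := _^T => Bu Bp.
(* Evaluating [alpha] with [x] in slot [i0] and the preimages of the other
   vectors of [v] elsewhere gives 0, but also a nonzero multiple of [alpha v]. *)
pose w := [tuple invmx B *m tnth v i | i < k].
have := x0 w i0; rewrite (slot_pullback _ _ _ Bp).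
have -> : [tuple B *m tnth w j | j < k] = v.
  by apply: eq_from_tnth => j; rewrite !tnth_mktuple mulKVmx.
have -> : B *m x = x + (dot x x * s) *: tnth v i0.
  rewrite /B linearD /= trmx1 trmx_mul trmxK mulmxDl mul1mx -mulmxA.
  by rewrite [x^T *m x]mx11_scalar mul_mx_scalar /u scalerA.
rewrite linearD /= x0 add0r linearZ /= slot_tnth => /eqP.
by rewrite !mulf_eq0 (negbTE sn0) (negbTE v0) !orbF gt_eqF ?dot_gt0.
Qed.

(** If [A *m x = 0] then [alpha], being its own pullback by [A], vanishes as soon
    as [x] fills one of its slots. *)
Lemma preserves_unitmx (i0 : 'I_k) v A :
  (forall A, stabilizer alpha A -> stabilizer alpha A^T) ->
  alpha v != 0 -> preserves A alpha -> A \in unitmx.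
Proof.
move=> htr v0 hA; rewrite -unitmx_tr -row_free_unit -kermx_eq0.
apply/negPn/negP => /rowV0Pn[y /sub_kermxP yA yn0].
have Ay : A *m y^T = 0 by rewrite -[A]trmxK -trmx_mul yA trmx0.
case/eqP: yn0; rewrite -[y]trmxK.
rewrite (@closed_trmx_nondegenerate i0 v y^T) ?trmx0 // => w i.
by rewrite (slot_pullback _ _ _ hA) Ay linear0.
Qed.

End AlternatingForms.

(** * Affine non-squeezing *)

Theorem proposition4p4 (R : realType) (k n : nat) (hk : (0 < k)%N)
    (alpha : altform R k n) (halpha : calibration alpha)
    (htr : forall A : 'M[R]_n, stabilizer alpha A -> stabilizer alpha A^T) :
  forall (Psi : 'M[R]_n) (x0 : 'cV[R]_n) (r rho : R),
    0 < r -> 0 < rho ->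
    preserves Psi alpha ->
    (exists L : oriented_subspace R k n,
       calibrated alpha L /\
       affine_map Psi x0 @` eball r `<=` cylinder L rho) ->
    r <= rho.
Proof.
move=> Psi x0 r rho r0 rho0 hPsi [L [[v [[vL _] vo v1]] sub]].
have PsiT : preserves Psi^T alpha.
  suff /htr[] : stabilizer alpha Psi by [].
  split=> //; apply: (@preserves_unitmx _ _ _ alpha (Ordinal hk) v) => //.
  by rewrite v1 oner_neq0.
have bnd y i : enorm y <= r -> `|dot (tnth v i) (Psi *m y + x0)| <= rho.
  move=> yr; rewrite -(dot_orthoproj _ _ vL vo).
  rewrite (le_trans (norm_dot_le _ _)) //.
    by move/orthonormal_tnthP: vo => vE; rewrite /enorm vE eqxx sqrtr1.
  rewrite -(ler_pXn2r (ltn0Sn 1)) ?nnegrE ?enorm_ge0 ?(ltW rho0) //.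
  by apply: (sub (affine_map Psi x0 y)); exists y.
have PsiTv i : enorm (Psi^T *m tnth v i) <= rho / r.
  set z := Psi^T *m tnth v i.
  have [->|zn0] := eqVneq z 0.
    by rewrite /enorm dot0r sqrtr0 divr_ge0 ?ltW.
  have z0 := enorm_gt0 zn0.
  pose y := (r / enorm z) *: z.
  have yr : enorm y <= r.
    by rewrite enormZ gtr0_norm ?divr_gt0 // divfK ?gt_eqF.
  have yNr : enorm (- y) <= r by rewrite -scaleN1r enormZ normrN1 mul1r.
  (* The difference of the values at [y] and [- y] eliminates [x0]. *)
  have := le_trans (ler_normB _ _) (lerD (bnd y i yr) (bnd (- y) i yNr)).
  have -> : dot (tnth v i) (Psi *m y + x0) - dot (tnth v i) (Psi *m - y + x0)
      = 2 * (r * enorm z).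
    rewrite !dotDr !dot_mulmx -/z dotNr dotZr dotvv.
    have -> : r / enorm z * enorm z ^+ 2 = r * enorm z.
      by field; rewrite gt_eqF.
    by ring.
  rewrite gtr0_norm ?mulr_gt0 // ler_pdivlMr // => H; lra.
have := comass_hadamard [tuple Psi^T *m tnth v i | i < k] halpha.1.
have -> : alpha [tuple Psi^T *m tnth v i | i < k] = 1.
  by rewrite -v1; exact: PsiT.
rewrite normr1 => ge1.
have : 1 <= (rho / r) ^+ k.
  rewrite -[k in _ ^+ k]card_ord -prodr_const (le_trans ge1) // ler_prod //.
  by move=> i _; rewrite tnth_mktuple enorm_ge0 PsiTv.
by rewrite expr_ge1 ?divr_ge0 ?(ltW r0) ?(ltW rho0) // ler_pdivlMr // mul1r.
Qed.
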